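(* (Volume conservation.) Let $q\in\{0,1\}$, $\eta>0$, $\sigma\in\mathbb R$, $\Delta t_m>0$, let $\vec X^m=(r^m,z^m)^\top\in\mathbb X^h$, and let $(\vec X^{m+1},\mu^{m+1})\in\mathbb X^h\times\mathbb K^h$ with $\vec X^{m+1}=(r^{m+1},z^{m+1})^\top$ be a solution of the scheme $$\frac1{\Delta t_m}\left\langle\vec X^{m+1}-\vec X^m,\ \varphi^h\vec f^{\,m+\frac12}\right\rangle-\left\langle r^m\partial_\rho\mu^{m+1},\ \partial_\rho\varphi^h\,|\partial_\rho\vec X^m|^{-1}\right\rangle=0\qquad\forall\varphi^h\in\mathbb K^h,$$ $$\begin{aligned}&\left\langle\mu^{m+1}\vec f^{\,m+\frac12},\ \vec\psi^h\right\rangle+\left\langle\gamma(\theta^{m+1}),\ \psi_1^h|\partial_\rho\vec X^{m+1}|\right\rangle+\left\langle r^m\boldsymbol B_q(\theta^m)\partial_\rho\vec X^{m+1},\ \partial_\rho\vec\psi^h\,|\partial_\rho\vec X^m|^{-1}\right\rangle\\&+\frac1{2\eta\Delta t_m}\left[(r_L^{m+1}+r_L^m)(r_L^{m+1}-r_L^m)\psi_1^h(1)+(r_0^{m+1}+r_0^m)(r_0^{m+1}-r_0^m)\psi_1^h(0)\right]\\&-\frac\sigma2\left[(r_L^{m+1}+r_L^m)\psi_1^h(1)-(r_0^{m+1}+r_0^m)\psi_1^h(0)\right]=0\qquad\forall\vec\psi^h=(\psi_1^h,\psi_2^h)^\top\in\mathbb X^h.\end{aligned}$$ Then $$\operatorname{vol}(\vec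 X^{m+1})-\operatorname{vol}(\vec X^m)=0 .$$
   Context: $\mathbb I=[0,1]$ is divided into $J$ intervals $\mathbb I_j=[q_{j-1},q_j]$, $q_j=jh$, $h=1/J$. $\mathbb K^h$ is the space of continuous functions on $\mathbb I$ that are affine on each $\mathbb I_j$, $\mathbb K^h_0$ its subspace of functions vanishing at $0$ and $1$, and $\mathbb X^h=\mathbb K^h\times\mathbb K^h_0$. $\langle\cdot,\cdot\rangle$ is the $L^2$ inner product over $\mathbb I$ with respect to $d\rho$ (scalar or vector functions). $(a,b)^\perp=(b,-a)$. For each time level $k$: $r_0^k=r^k(0)$, $r_L^k=r^k(1)$; it is assumed that $r^k>0$ on $(0,1]$ and $|\partial_\rho\vec X^k|>0$ on each element; $\theta^k$ (mod $2\pi$, constant on each element) is defined by $\partial_\rho\vec X^k/|\partial_\rho\vec X^k|=(\cos\theta^k,\sin\theta^k)^\top$. Moreover $$\vec f^{\,m+\frac12}=-\frac16\left[2r^m\partial_\rho\vec X^m+2r^{m+1}\partial_\rho\vec X^{m+1}+r^m\partial_\rho\vec X^{m+1}+r^{m+1}\partial_\rho\vec X^m\right]^\perp .$$ $\gamma=\gamma(\theta)>0$ is a $C^2$, even, $2\pi$-periodic surface energy density, $\mathscr S(\theta)$ a given real-valued ($2\pi$-periodic) stability function, and for $q\in\{0,1\}$ $$\boldsymbol{B}_q(\theta)=\begin{pmatrix}\gamma(\theta)&-\gamma'(\theta)\\ \gamma'(\theta)&\gamma(\theta)\end{pmatrix}\begin{pmatrix}\cos2\theta&\sin2\theta\\ \sin2\theta&-\cos2\theta\end{pmatrix}^{1-q}+\mathscr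 S(\theta)\left[\frac12\boldsymbol I-\frac12\begin{pmatrix}\cos2\theta&\sin2\theta\\ \sin2\theta&-\cos2\theta\end{pmatrix}\right],$$ with $\boldsymbol I$ the $2\times2$ identity matrix. The enclosed volume of $\vec X=(r,z)^\top\in\mathbb X^h$ is $$\operatorname{vol}(\vec X)=2\pi\int_{\mathbb I} r\,z\,\partial_\rho r\,d\rho .$$ *)

(* Defs.v *)
(* Mathematical Components with MathComp-Analysis. *)
From HB Require Import structures.
From mathcomp Require Import all_boot all_order all_algebra.
From mathcomp Require Import all_classical all_reals all_analysis.

Set Implicit Arguments.
Unset Strict Implicit.
Unset Printing Implicit Defensive.

Import Order.TTheory GRing.Theory Num.Theory.
Import numFieldNormedType.Exports.

Local Open Scope classical_set_scope.
Local Open Scope ring_scope.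

Definition col2 (R : realType) (a b : R) : 'cV[R]_2 :=
  \col_i (if i == 0 then a else b).

Definition mx2 (R : realType) (a b c d : R) : 'M[R]_2 :=
  \matrix_(i, j) (if i == 0 then (if j == 0 then a else b)
                            else (if j == 0 then c else d)).

Definition dot (R : realType) (u v : 'cV[R]_2) : R := \sum_i u i 0 * v i 0.

(* The library norm on matrices is the sup norm. *)
Definition enorm (R : realType) (u : 'cV[R]_2) : R := Num.sqrt (dot u u).

Definition perp (R : realType) (u : 'cV[R]_2) : 'cV[R]_2 :=
  col2 (u 1 0) (- u 0 0).

Definition ipS (R : realType) (f g : R -> R) : R :=
  \int[lebesgue_measure]_(rho in `[0, 1]) (f rho * g rho).

Definition ipV (R : realType) (u v : R -> 'cV[R]_2) : R :=
  \int[lebesgue_measure]_(rho in `[0, 1]) dot (u rho) (v rho).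

Definition node (R : realType) (J : nat) (j : nat) : R := j%:R / J%:R.

(* Functions on [0, 1] are represented by functions on R; what they do outside
   [0, 1] is irrelevant, up to the value of their derivative at 0 and 1, which
   is never used outside of an integral. *)
Definition Kh (R : realType) (J : nat) (f : R -> R) : Prop :=
  {within `[0, 1], continuous f} /\
  forall j : 'I_J, exists a b : R,
    forall rho, rho \in `[node R J j, node R J j.+1] -> f rho = a * rho + b.

Definition Kh0 (R : realType) (J : nat) (f : R -> R) : Prop :=
  [/\ Kh J f, f 0 = 0 & f 1 = 0].

(* An element (r, z) of the product space is a pair of scalar functions. *)
Definition Xh (R : realType) (J : nat) (X : (R -> R) * (R -> R)) : Prop :=
  Kh J X.1 /\ Kh0 J X.2.

Definition vec (R : realType) (X : (R -> R) * (R -> R)) (rho : R) : 'cV[R]_2 :=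
  col2 (X.1 rho) (X.2 rho).

(* At the nodes, a null set, the derivative of a piecewise affine function may
   take an irrelevant default value. *)
Definition dvec (R : realType) (X : (R -> R) * (R -> R)) (rho : R)
  : 'cV[R]_2 := col2 (derive1 X.1 rho) (derive1 X.2 rho).

(* Elementwise conditions on derivatives are imposed on the open elements,
   where the derivative exists. *)
Definition regular_curve (R : realType) (J : nat) (X : (R -> R) * (R -> R))
  : Prop :=
  (forall rho, rho \in `]0, 1] -> 0 < X.1 rho) /\
  (forall (j : 'I_J) rho, rho \in `]node R J j, node R J j.+1[ ->
     0 < enorm (dvec X rho)).

(* theta is any representative modulo 2 pi of the tangent angle. *)
Definition tangent_angle (R : realType) (J : nat) (X : (R -> R) * (R -> R))
    (theta : R -> R) : Prop :=
  forall j : 'I_J, exists c : R,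
    forall rho, rho \in `]node R J j, node R J j.+1[ ->
      theta rho = c /\
      (enorm (dvec X rho))^-1 *: dvec X rho = col2 (cos c) (sin c).

(* (X0, X1) stand for the curves at time levels m and m + 1. *)
Definition fhalf (R : realType) (X0 X1 : (R -> R) * (R -> R)) (rho : R)
  : 'cV[R]_2 :=
  - (6^-1 *: perp ((2 * X0.1 rho) *: dvec X0 rho
                   + (2 * X1.1 rho) *: dvec X1 rho
                   + X0.1 rho *: dvec X1 rho
                   + X1.1 rho *: dvec X0 rho)).

Definition reflmx (R : realType) (theta : R) : 'M[R]_2 :=
  mx2 (cos (2 * theta)) (sin (2 * theta))
      (sin (2 * theta)) (- cos (2 * theta)).

Definition Bq (R : realType) (q : 'I_2) (gamma S : R -> R) (theta : R)
  : 'M[R]_2 :=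
  mx2 (gamma theta) (- derive1 gamma theta)
      (derive1 gamma theta) (gamma theta)
    *m reflmx theta ^+ (1 - q)
  + S theta *: (2^-1 *: 1%:M - 2^-1 *: reflmx theta).

Definition surface_energy_density (R : realType) (gamma : R -> R) : Prop :=
  [/\ forall t, 0 < gamma t,
      forall t, derivable gamma t 1 /\ derivable (derive1 gamma) t 1,
      continuous (derive1n 2 gamma),
      forall t, gamma (- t) = gamma t
    & forall t, gamma (t + 2 * pi) = gamma t].

Definition vol (R : realType) (X : (R -> R) * (R -> R)) : R :=
  2 * pi * \int[lebesgue_measure]_(rho in `[0, 1])
             (X.1 rho * X.2 rho * derive1 X.1 rho).

(* Main.v *)
Require Import Defs.
From mathcomp Require Import all_boot all_order all_algebra.
From mathcomp Require Import all_classical all_reals all_analysis.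
From mathcomp Require Import measurable_realfun ring.

Set Implicit Arguments.
Unset Strict Implicit.
Unset Printing Implicit Defensive.

Import Order.TTheory GRing.Theory Num.Theory.
Import numFieldNormedType.Exports.

Local Open Scope classical_set_scope.
Local Open Scope ring_scope.

(** The first equation of the scheme, tested with [phi = 1], loses its
    diffusion term and says that the increment [X1 - X0] is orthogonal to
    [fhalf X0 X1]. It remains to see that [2 pi] times the inner product of
    these two is the exact increment of the volume, for any two curves of the
    finite element space; this is [vol_increment].

    The reason is that [fhalf] is a time average. On the segment
    [X_s = (r_s, z_s) = X0 + s (X1 - X0)], writing [dr = r1 - r0] and
    [dz = z1 - z0], the integrand of the volume varies at the rate
    [d/ds (r_s z_s r_s') = r_s (dz r_s' - dr z_s') + (r_s z_s dr)'],
    where the prime is the derivative in [rho]. The function [r_s X_s'] is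
    quadratic in [s], and its average over [s] in [0, 1] is
    [(2 r0 X0' + 2 r1 X1' + r0 X1' + r1 X0') / 6], so the first term averages to
    the scalar product of the increment with [fhalf]. The second one is an
    exact derivative in [rho] and integrates to zero over [0, 1], because [z]
    vanishes at both ends.

    Averaged over [s], this is an identity between polynomials on each element
    ([dot_increment_fhalf] and the proof of [vol_increment]). The derivatives
    jump at the nodes, so the integrals are computed element by element with
    the fundamental theorem of calculus for polynomials, and the boundary terms
    telescope because the primitive is defined on the whole of [0, 1]
    ([Rintegral_mesh]). *)

(** * Integrals of piecewise polynomial functions *)

Section piecewise_polynomial.
Context {R : realType}.
Notation mu := lebesgue_measure.
Implicit Types (f G : R -> R) (p : {poly R}) (a b c : R).

Lemma within_continuous_horner p (A : set R) : {within A, continuous (horner p)}.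
Proof. by apply: continuous_subspaceT => x; exact: continuous_horner. Qed.

(** The agreement is only on the open interval because it is applied to
    derivatives of piecewise affine functions, whose values at the nodes are
    arbitrary: the two end points form a null set. *)
Lemma integrable_eq_horner p f a b :
  {in `]a, b[, f =1 horner p} -> mu.-integrable `[a, b] (EFin \o f).
Proof.
move=> fp.
have foo : mu.-integrable `]a, b[ (EFin \o f).
  apply: (@eq_integrable _ (measurableTypeR R) _ _ _ _ (EFin \o horner p)) => //.
    by move=> x /[!inE] xab /=; rewrite fp.
  apply: (@integrableS _ (measurableTypeR R) _ _ `[a, b]) => //; first exact: subset_itv_oo_cc.
  apply: continuous_compact_integrable; first exact: segment_compact.
  exact: within_continuous_horner.
have [mf ifoo] := integrableP _ _ _ foo.
apply/integrableP; split; first exact: emeasurable_fun_itv_cc mf.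
rewrite integral_itv_bndoo //; exact: (measurableT_comp (@abse_measurable R setT) mf).
Qed.

Lemma Rintegral_deriv_horner p f G a b : a <= b ->
  {in `]a, b[, f =1 horner p^`()} -> {in `[a, b], G =1 horner p} ->
  \int[mu]_(x in `[a, b]) f x = G b - G a.
Proof.
rewrite le_eqVlt => /predU1P[<- _ _|ab fp Gp].
  by rewrite set_itv1 Rintegral_set1 subrr.
have [mf _] := integrableP _ _ _ (integrable_eq_horner fp).
have [mp _] := integrableP _ _ _
  (@integrable_eq_horner p^`() _ a b (fun x _ => erefl)).
have sub := @subset_itv_oo_cc _ _ a b.
rewrite /Rintegral (@eq_integral_itv_bounded _ _ _ (horner p^`()))//.
- rewrite (@continuous_FTC2 _ _ (horner p))//.
  + by rewrite -EFinB /= !Gp// in_itv/= lexx ltW.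
  + exact: within_continuous_horner.
  + split; first by move=> x _; exact: derivable_horner.
      by apply: cvg_at_right_filter; exact: continuous_horner.
    by apply: cvg_at_left_filter; exact: continuous_horner.
  + by move=> x _; rewrite derivE.
- exact: (measurable_funS (measurable_itv _) sub ((measurable_EFinP _ _).1 mf)).
- exact: (measurable_funS (measurable_itv _) sub ((measurable_EFinP _ _).1 mp)).
Qed.

Lemma integrable_itv_cat f a b c : a <= b -> b <= c ->
  mu.-integrable `[a, b] (EFin \o f) -> mu.-integrable `[b, c] (EFin \o f) ->
  mu.-integrable `[a, c] (EFin \o f).
Proof.
move=> ab bc iab ibc.
have ibc' : mu.-integrable `]b, c] (EFin \o f).
  by apply: integrableS ibc => //; exact: subset_itv_oc_cc.
have [[mab fab] [mbc fbc]] := (integrableP _ _ _ iab, integrableP _ _ _ ibc').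
have -> : `[a, c]%classic = `[a, b] `|` `]b, c] :> set R.
  by rewrite -itv_bndbnd_setU// bnd_simp.
have mU : measurable_fun (`[a, b] `|` `]b, c] : set R) (EFin \o f).
  by apply/measurable_funU.
apply/integrableP; split => //; rewrite ge0_integral_setU//.
- exact: lte_add_pinfty.
- exact: (measurableT_comp (@abse_measurable R setT) mU).
- apply/disj_setPS => y [/=]; rewrite 2!in_itv/= => /andP[_ yb] /andP[].
  by rewrite ltNge yb.
Qed.

Lemma Rintegral_itv_cat f a b c : a <= b -> b <= c ->
  mu.-integrable `[a, b] (EFin \o f) -> mu.-integrable `[b, c] (EFin \o f) ->
  \int[mu]_(x in `[a, c]) f x =
  \int[mu]_(x in `[a, b]) f x + \int[mu]_(x in `[b, c]) f x.
Proof.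
move=> ab bc iab ibc; have iac := integrable_itv_cat ab bc iab ibc.
rewrite -(@Rintegral_itv_obnd_cbnd _ b); last first.
  by apply: integrableS ibc => //; exact: subset_itv_oc_cc.
by rewrite -(Rintegral_itvB iac) ?bnd_simp// addrC subrK.
Qed.

Lemma integrable_mesh (x : nat -> R) n f :
  {homo x : i j / (i <= j)%N >-> i <= j} ->
  (forall j, (j < n)%N -> mu.-integrable `[x j, x j.+1] (EFin \o f)) ->
  mu.-integrable `[x 0, x n] (EFin \o f).
Proof.
move=> x_incr; elim: n => [|n IHn] fi.
  (* The interval is a single point, and its interior is empty. *)
  apply: (@integrable_eq_horner 0) => y; rewrite in_itv/= => /andP[xy yx].
  by have := lt_trans xy yx; rewrite ltxx.
apply: (integrable_itv_cat (x_incr _ _ (leq0n n)) (x_incr _ _ (leqnSn n))).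
  by apply: IHn => j jn; apply: fi; exact: ltnW.
exact: fi.
Qed.

(** The polynomials may change from one element to the next, but the single
    function [G] matches them on closed elements, so that its values at the
    interior nodes cancel. *)
Lemma Rintegral_mesh (x : nat -> R) n f G :
  {homo x : i j / (i <= j)%N >-> i <= j} ->
  (forall j, (j < n)%N -> exists p,
    {in `]x j, x j.+1[, f =1 horner p^`()} /\
    {in `[x j, x j.+1], G =1 horner p}) ->
  \int[mu]_(y in `[x 0, x n]) f y = G (x n) - G (x 0).
Proof.
move=> x_incr; elim: n => [|n IHn] fG.
  by rewrite set_itv1 Rintegral_set1 subrr.
have fi j : (j < n.+1)%N -> mu.-integrable `[x j, x j.+1] (EFin \o f).
  by move=> /fG[p [fp _]]; exact: integrable_eq_horner fp.
rewrite (Rintegral_itv_cat (x_incr _ _ (leq0n n)) (x_incr _ _ (leqnSn n))).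
- rewrite IHn => [|j jn]; last by apply: fG; exact: ltnW.
  have [p [fp Gp]] := fG n (ltnSn n).
  by rewrite (Rintegral_deriv_horner (x_incr _ _ (leqnSn n)) fp Gp); ring.
- by apply: integrable_mesh => // j jn; apply: fi; exact: ltnW.
- exact: fi.
Qed.

Lemma derive1_eq_horner p f a b : {in `[a, b], f =1 horner p} ->
  {in `]a, b[, derive1 f =1 horner p^`()}.
Proof.
move=> fp x xab; rewrite derivE !derive1E; apply: near_eq_derive.
near=> y; apply: fp; apply: subset_itv_oo_cc; near: y.
exact: near_in_itvoo.
Unshelve. all: by end_near. Qed.

End piecewise_polynomial.

(** * The volume increment on the finite element space *)

Section finite_elements.
Context {R : realType} (J : nat) (J_gt0 : (0 < J)%N).
Notation mu := lebesgue_measure.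

Lemma node_homo : {homo @node R J : i j / (i <= j)%N >-> i <= j}.
Proof. by move=> i j ij; rewrite ler_wpM2r ?invr_ge0 ?ler_nat. Qed.

Lemma node0 : node R J 0 = 0. Proof. by rewrite /node mul0r. Qed.

Lemma nodeJ : node R J J = 1.
Proof. by rewrite /node divff// pnatr_eq0 -lt0n. Qed.

Lemma Kh_eq_horner (f : R -> R) j : Kh J f -> (j < J)%N ->
  exists p : {poly R}, {in `[node R J j, node R J j.+1], f =1 horner p}.
Proof.
move=> [_ faff] jJ; have [a [b fab]] := faff (Ordinal jJ).
by exists (a *: 'X + b%:P) => x xj; rewrite fab// !hornerE.
Qed.

Lemma Kh_cst (c : R) : Kh J (cst c).
Proof.
split; first by apply: continuous_subspaceT => x; exact: cvg_cst.
by move=> j; exists 0, c => x _; rewrite mul0r add0r.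
Qed.

Lemma dot_increment_fhalf (X0 X1 : (R -> R) * (R -> R)) (x : R) :
  dot (vec X1 x - vec X0 x) (fhalf X0 X1 x) =
  6^-1 *
  ((X1.2 x - X0.2 x) * ((2 * X0.1 x + X1.1 x) * derive1 X0.1 x
                        + (2 * X1.1 x + X0.1 x) * derive1 X1.1 x)
   - (X1.1 x - X0.1 x) * ((2 * X0.1 x + X1.1 x) * derive1 X0.2 x
                          + (2 * X1.1 x + X0.1 x) * derive1 X1.2 x)).
Proof.
rewrite /dot big_ord_recl big_ord1.
by rewrite /fhalf /vec /perp /dvec /col2 !mxE /=; ring.
Qed.

(** The first variation of the volume pairs a small displacement with
    [- r (X')^perp]; averaging this field over the segment from [X0] to [X1],
    as [fhalf] does, makes the formula exact for the whole displacement. *)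
Lemma vol_increment (X0 X1 : (R -> R) * (R -> R)) : Xh J X0 -> Xh J X1 ->
  vol X1 - vol X0 =
  2 * pi * ipV (fun x => vec X1 x - vec X0 x) (fhalf X0 X1).
Proof.
move=> [Kr0 [Kz0 z00 z01]] [Kr1 [Kz1 z10 z11]].
pose v (X : (R -> R) * (R -> R)) x := X.1 x * X.2 x * derive1 X.1 x.
pose w x := dot (vec X1 x - vec X0 x) (fhalf X0 X1 x).
(* [G] is the average over [s] in [0, 1] of [r_s z_s (r1 - r0)]. *)
pose G x := 6^-1 * ((X1.1 x - X0.1 x) *
  (2 * (X0.1 x * X0.2 x) + 2 * (X1.1 x * X1.2 x)
   + X0.1 x * X1.2 x + X1.1 x * X0.2 x)).
pose e j := `]node R J j, node R J j.+1[.
have elt j : (j < J)%N -> exists p0 p1 pw : {poly R}, exists P,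
    [/\ {in e j, v X0 =1 horner p0}, {in e j, v X1 =1 horner p1},
        {in e j, w =1 horner pw}, {in `[node R J j, node R J j.+1], G =1 horner P}
      & p1 - p0 - pw = P^`()].
  move=> jJ.
  have [r0 r0E] := Kh_eq_horner Kr0 jJ; have [z0 z0E] := Kh_eq_horner Kz0 jJ.
  have [r1 r1E] := Kh_eq_horner Kr1 jJ; have [z1 z1E] := Kh_eq_horner Kz1 jJ.
  exists (r0 * z0 * r0^`()), (r1 * z1 * r1^`()),
    ((6^-1)%:P * ((z1 - z0) * ((2 * r0 + r1) * r0^`() + (2 * r1 + r0) * r1^`())
      - (r1 - r0) * ((2 * r0 + r1) * z0^`() + (2 * r1 + r0) * z1^`()))),
    ((6^-1)%:P * ((r1 - r0) * (2 * (r0 * z0) + 2 * (r1 * z1)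
      + r0 * z1 + r1 * z0))).
  have two (y : R) : (2 : {poly R}).[y] = 2 by rewrite -polyC_natr hornerC.
  have six : (6^-1 : R)%:P * 6 = 1.
    by rewrite -polyC_natr -polyCM mulVf// pnatr_eq0.
  split.
  - move=> y yj; have yj' := subset_itv_oo_cc yj.
    by rewrite /v r0E// z0E// (derive1_eq_horner r0E)// !hornerE.
  - move=> y yj; have yj' := subset_itv_oo_cc yj.
    by rewrite /v r1E// z1E// (derive1_eq_horner r1E)// !hornerE.
  - move=> y yj; have yj' := subset_itv_oo_cc yj.
    rewrite /w dot_increment_fhalf r0E// z0E// r1E// z1E//.
    rewrite (derive1_eq_horner r0E)// (derive1_eq_horner r1E)//.
    rewrite (derive1_eq_horner z0E)// (derive1_eq_horner z1E)//.
    by rewrite !(hornerE, two).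
  - by move=> y yj; rewrite /G r0E// r1E// z0E// z1E// !(hornerE, two).
  - have two' : (2 : {poly R})^`() = 0 by rewrite -polyC_natr derivC.
    rewrite !(derivCE, two').
    (* Only the densities [r z r'] lack the common factor [1 / 6]. *)
    by rewrite -[_ - r0 * z0 * _]mul1r -{1}six; ring.
have itv01 : `[0, 1]%classic = `[node R J 0, node R J J]%classic :> set R.
  by rewrite node0 nodeJ.
have iv0 : mu.-integrable `[0, 1] (EFin \o v X0).
  rewrite itv01; apply: integrable_mesh node_homo _ => j /elt.
  by move=> [p0 [p1 [pw [P [/integrable_eq_horner]]]]].
have iv1 : mu.-integrable `[0, 1] (EFin \o v X1).
  rewrite itv01; apply: integrable_mesh node_homo _ => j /elt.
  by move=> [p0 [p1 [pw [P [_ /integrable_eq_horner]]]]].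
have iw : mu.-integrable `[0, 1] (EFin \o w).
  rewrite itv01; apply: integrable_mesh node_homo _ => j /elt.
  by move=> [p0 [p1 [pw [P [_ _ /integrable_eq_horner]]]]].
have iv10 : mu.-integrable `[0, 1] (EFin \o (fun x => v X1 x - v X0 x)).
  by apply: eq_integrable (integrableB _ iv1 iv0).
have : \int[mu]_(x in `[0, 1]) (v X1 x - v X0 x - w x) = 0.
  rewrite itv01 (Rintegral_mesh (G := G) node_homo).
    by rewrite node0 nodeJ /G z00 z01 z10 z11; ring.
  move=> j /elt [p0 [p1 [pw [P [v0E v1E wE GE PE]]]]]; exists P; split => //.
  by move=> y yj; rewrite v0E// v1E// wE// -PE !hornerE.
rewrite RintegralB// RintegralB// => /eqP; rewrite subr_eq0 => /eqP vw.
by rewrite /vol /ipV -/(v X1) -/(v X0) -mulrBr vw.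
Qed.

End finite_elements.

Theorem theorem4p1 (R : realType) (J : nat) (hJ : (0 < J)%N)
  (q : 'I_2) (eta sigma dt : R) (heta : 0 < eta) (hdt : 0 < dt)
  (gamma S : R -> R) (hgamma : surface_energy_density gamma)
  (hS : forall t, S (t + 2 * pi) = S t)
  (X0 X1 : (R -> R) * (R -> R)) (mu theta0 theta1 : R -> R)
  (hX0 : Xh J X0) (hX1 : Xh J X1) (hmu : Kh J mu)
  (hreg0 : regular_curve J X0) (hreg1 : regular_curve J X1)
  (htheta0 : tangent_angle J X0 theta0)
  (htheta1 : tangent_angle J X1 theta1)
  (scheme1 : forall phi : R -> R, Kh J phi ->
     dt^-1 * ipV (fun rho => vec X1 rho - vec X0 rho)
                 (fun rho => phi rho *: fhalf X0 X1 rho)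
     - ipS (fun rho => X0.1 rho * derive1 mu rho)
           (fun rho => derive1 phi rho * (enorm (dvec X0 rho))^-1) = 0)
  (scheme2 : forall psi : (R -> R) * (R -> R), Xh J psi ->
     ipV (fun rho => mu rho *: fhalf X0 X1 rho) (vec psi)
     + ipS (fun rho => gamma (theta1 rho))
           (fun rho => psi.1 rho * enorm (dvec X1 rho))
     + ipV (fun rho => X0.1 rho *: (Bq q gamma S (theta0 rho) *m dvec X1 rho))
           (fun rho => (enorm (dvec X0 rho))^-1 *: dvec psi rho)
     + (2 * eta * dt)^-1 *
         ((X1.1 1 + X0.1 1) * (X1.1 1 - X0.1 1) * psi.1 1
          + (X1.1 0 + X0.1 0) * (X1.1 0 - X0.1 0) * psi.1 0)
     - sigma / 2 *
         ((X1.1 1 + X0.1 1) * psi.1 1 - (X1.1 0 + X0.1 0) * psi.1 0) = 0) :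
  vol X1 - vol X0 = 0.
Proof.
have increment_orth : ipV (fun x => vec X1 x - vec X0 x) (fhalf X0 X1) = 0.
  have := scheme1 _ (Kh_cst J 1).
  rewrite [X in _ - X](_ : _ = 0); last first.
    rewrite /ipS; under eq_Rintegral do rewrite derive1_cst mul0r mulr0.
    by rewrite /Rintegral integral0.
  rewrite subr0 => /eqP; rewrite mulf_eq0 invr_eq0 gt_eqF//= => /eqP.
  by under [X in ipV _ X]funext do rewrite scale1r.
by rewrite (vol_increment hJ hX0 hX1) increment_orth mulr0.
Qed.
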